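(* Let $\phi$ be a Drinfeld $A[\underline{t}_s]$-module over $\mathbb{T}_s$ with $\phi_\theta=\theta+A_1\tau+\dots+A_r\tau^r$, $A_r\in\mathbb{T}_s^\times$, and let $\Phi$ be the matrix described below. Fix $\mathbf{h}=[h_1,\dots,h_r]\in\mathrm{Mat}_{1\times r}(\mathbb{T}_s[z])$, and suppose there exists $\mathbf{g}=[g_1,\dots,g_r]\in\mathrm{Mat}_{1\times r}(\mathbb{T}_s\{z/\theta\})$ with \[ \mathbf{g}^{(-1)}\Phi-\mathbf{g}=\mathbf{h}. \] Let $\Xi=\delta_1(\iota(\mathbf{h}))\in\mathbb{T}_s$ and $\xi=(g_1+h_1)|_{z=\theta}\in\mathbb{T}_s$. Then $\exp_\phi(\xi)=\Xi$.
   Context: $\mathbb{F}_q$ finite field, $\theta,t_1,\dots,t_s,z$ independent variables, $A[\underline{t}_s]=\mathbb{F}_q[\theta,t_1,\dots,t_s]$, $\mathbb{F}_q[\underline{t}_s]=\mathbb{F}_q[t_1,\dots,t_s]$. $\mathbb{C}_\infty$: completion of an algebraic closure of $\mathbb{F}_q((1/\theta))$, $|\theta|_\infty=q$. $\mathbb{T}_s$: Tate algebra of power series in $t_1,\dots,t_s$ over $\mathbb{C}_\infty$ with coefficients tending to $0$, Gauss norm $\|\cdot\|_\infty$. $\tau$: automorphism raising $\mathbb{C}_\infty$-coefficients to the $q$-th power, $f^{(n)}=\tau^n(f)$ for $n\in\mathbb{Z}$, applied entrywise to matrices and coefficientwise to power series in $z$ (fixing $z$); $\sigma=\tau^{-1}$.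 $\mathbb{T}_s[\tau]$, $\mathbb{T}_s[[\tau]]$: twisted rings with $\tau f=f^{(1)}\tau$, acting on $\mathbb{T}_s$ by $\sum a_i\tau^i(f)=\sum a_if^{(i)}$. A Drinfeld $A[\underline{t}_s]$-module is an $\mathbb{F}_q[\underline{t}_s]$-algebra homomorphism $\phi:A[\underline{t}_s]\to\mathbb{T}_s[\tau]$ with $\phi_\theta=\theta+A_1\tau+\dots+A_r\tau^r$; $\exp_\phi=\sum\alpha_i\tau^i$ is the unique series with $\alpha_0=1$, $\exp_\phi a=\phi_a\exp_\phi$; it converges on $\mathbb{T}_s$. $\mathbb{T}_s\{z/\theta\}=\{\sum_{i\ge0}a_iz^i: a_i\in\mathbb{T}_s,\ q^i\|a_i\|_\infty\to0\}$; its elements may be evaluated at $z=\theta$. $\Phi\in\mathrm{Mat}_r(\mathbb{T}_s[z])$ has $i$-th row equal to the $(i+1)$-st standard basis row vector for $1\le i\le r-1$, and last row $\big[(z-\theta)/A_r^{(-r)},-A_1^{(-1)}/A_r^{(-r)},\dots,-A_{r-1}^{(-r+1)}/A_r^{(-r)}\big]$. $\mathbb{T}_s[\sigma]$ is the twisted polynomial ring with $\sigma f=f^{(-1)}\sigma$; it is a left $\mathbb{T}_s[z]$-module via $c z^k\cdot m=c\,m(\phi_\theta^* )^k$ ($c\in\mathbb{T}_s$), where $\phi_\theta^*=\theta+A_1^{(-1)}\sigma+\dots+A_r^{(-r)}\sigma^r$. Define $\iota:\mathrm{Mat}_{1\times r}(\mathbb{T}_s[z])\to\mathbb{T}_s[\sigma]$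 by $\iota([h_1,\dots,h_r])=\sum_{i=1}^r h_i\cdot\sigma^{i-1}$, and $\delta_1:\mathbb{T}_s[\sigma]\to\mathbb{T}_s$ by $\delta_1(\sum_i a_i\sigma^i)=\sum_i a_i^{(i)}$. *)

(* Defs.v *)
From HB Require Import structures.
From mathcomp Require Import all_boot all_order all_algebra.
From mathcomp Require Import reals.
Set Implicit Arguments. Unset Strict Implicit. Unset Printing Implicit Defensive.
Import Order.TTheory GRing.Theory Num.Theory.
Local Open Scope ring_scope.

(* The field C_infty, characterized up to isometric isomorphism:      *)
(* K algebraically closed, with a non-archimedean absolute value nrm, *)
(* complete, containing F_q (via iF) and theta with |theta| = q, and  *)
(* such that the elements algebraic over F_q(theta) are dense.        *)

Definition alg_over_Fqtheta (F : finFieldType) (K : fieldType)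
  (iF : {rmorphism F -> K}) (theta y : K) : Prop :=
  exists p : {poly {poly F}},
    p != 0 /\ (map_poly (fun c : {poly F} => (map_poly iF c).[theta]) p).[y] = 0.

Definition is_Cinfty (R : realType) (F : finFieldType) (K : closedFieldType)
  (iF : {rmorphism F -> K}) (nrm : K -> R) (theta : K) : Prop :=
  (forall x, 0 <= nrm x) /\
      (forall x, nrm x = 0 <-> x = 0) /\
      (forall x y, nrm (x * y) = nrm x * nrm y) /\
      (forall x y, nrm (x + y) <= Num.max (nrm x) (nrm y)) /\
      (forall u : nat -> K,
         (forall eps : R, 0 < eps -> exists N, forall m n : nat,
            (N <= m)%N -> (N <= n)%N -> nrm (u m - u n) < eps) ->
         exists l, forall eps : R, 0 < eps -> exists N, forall n : nat,
            (N <= n)%N -> nrm (u n - l) < eps) /\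
      nrm theta = (#|F|)%:R /\
      (forall x (eps : R), 0 < eps ->
         exists y, alg_over_Fqtheta iF theta y /\ nrm (x - y) < eps).

Lemma root_ex (K : closedFieldType) (m : nat) (x : K) :
  exists y : K, y ^+ m.+1 == x.
Proof.
have [|y Hy] := @solve_monicpoly K m.+1 (fun i => if i == 0%N then x else 0) _ => //.
exists y; apply/eqP; rewrite Hy big_ord_recl /= expr0 mulr1 big1 ?addr0 // => i _.
by rewrite mul0r.
Qed.

(* q-th root (q > 0); in characteristic p with q a power of p it is unique *)
Definition qroot (K : closedFieldType) (q : nat) (x : K) : K :=
  xchoose (root_ex q.-1 x).

Definition tw (K : closedFieldType) (q : nat) (n : int) (x : K) : K :=
  match n with
  | Posz m => iter m (fun y => y ^+ q) x
  | Negz m => iter m.+1 (qroot q) x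
  end.

(* The Tate algebra T_s: power series in t_1..t_s, represented by     *)
(* their coefficient functions on multi-indices N^s.                  *)

Definition midx (s : nat) := {ffun 'I_s -> nat}.
Definition tser (K : Type) (s : nat) := midx s -> K.

Definition mzero (s : nat) : midx s := [ffun => 0%N].
Definition mdeg (s : nat) (nu : midx s) : nat := (\sum_(i < s) nu i)%N.

Definition tate (R : realType) (K : Type) (nrm : K -> R) (s : nat) (f : tser K s) :=
  forall eps : R, 0 < eps -> exists N, forall nu : midx s,
    (N <= mdeg nu)%N -> nrm (f nu) < eps.

Section TateOps.
Variables (K : closedFieldType) (s : nat).

Definition tzero : tser K s := fun _ => 0.
Definition tconst (c : K) : tser K s := fun nu => if nu == mzero s then c else 0.
Definition tone : tser K s := tconst 1.
Definition tscale (c : K) (f : tser K s) : tser K s := fun nu => c * f nu.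

Definition tmul (f g : tser K s) : tser K s := fun nu =>
  \sum_(mu : {ffun 'I_s -> 'I_(mdeg nu).+1} | [forall i, (mu i <= nu i)%N])
     f [ffun i => nat_of_ord (mu i)] * g [ffun i => (nu i - mu i)%N].

Definition ttw (q : nat) (n : int) (f : tser K s) : tser K s :=
  fun nu => tw q n (f nu).

(* Gauss-norm convergence of a sequence in T_s to a limit *)
Definition tconv (R : realType) (nrm : K -> R) (S : nat -> tser K s) (L : tser K s) :=
  forall eps : R, 0 < eps -> exists N, forall n : nat, (N <= n)%N ->
    forall nu : midx s, nrm (S n nu - L nu) < eps.

(* Power series in z over T_s (coefficient functions nat -> T_s).     *)
Definition zser := nat -> tser K s.

Definition zmul (a b : zser) : zser := fun k nu =>
  \sum_(m < k.+1) tmul (a m) (b (k - m)%N) nu.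

Definition ztw (q : nat) (n : int) (a : zser) : zser := fun k => ttw q n (a k).

(* The matrix Phi (0-based indices i j : 'I_r); A j stands for A_j
   (1 <= j <= r), Binv is the inverse of A_r in T_s. Entry (i,j):
   rows i < r-1: the (i+1)-st standard basis vector;
   last row: [(z - theta)/A_r^{(-r)}, -A_1^{(-1)}/A_r^{(-r)}, ...]. *)
Definition Phi (q r : nat) (theta : K) (A : nat -> tser K s) (Binv : tser K s)
  (i j : 'I_r) : zser :=
  let Bt := ttw q (- (r%:Z)) Binv in
  if (i.+1 < r)%N then
    (fun k => if (k == 0%N) && (nat_of_ord j == i.+1) then tone else tzero)
  else if nat_of_ord j == 0%N then
    (fun k => if k == 0%N then tmul (tconst (- theta)) Bt
              else if k == 1%N then Bt else tzero)
  else
    (fun k => if k == 0%N then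
                (fun nu => - tmul (ttw q (- ((nat_of_ord j)%:Z)) (A j)) Bt nu)
              else tzero).

Definition zeval_partial (theta : K) (a : zser) : nat -> tser K s :=
  fun n nu => \sum_(k < n) a k nu * theta ^+ k.

(* Twisted polynomials T_s[sigma] (coefficient functions nat -> T_s), *)
(* with  sigma f = f^{(-1)} sigma.                                    *)
Definition tpol := nat -> tser K s.

Definition tpmul (q : nat) (P Q : tpol) : tpol := fun n nu =>
  \sum_(m < n.+1) tmul (P m) (ttw q (- (m%:Z)) (Q (n - m)%N)) nu.

Definition tpone : tpol := fun n => if n == 0%N then tone else tzero.
Definition sigpow (i : nat) : tpol := fun n => if n == i then tone else tzero.
Definition tppow (q : nat) (P : tpol) (k : nat) : tpol :=
  iter k (fun Q => tpmul q Q P) tpone.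

Definition phistar (q r : nat) (theta : K) (A : nat -> tser K s) : tpol :=
  fun n => if n == 0%N then tconst theta
           else if (n <= r)%N then ttw q (- (n%:Z)) (A n) else tzero.

(* iota([h_1,..,h_r]) = sum_i h_i . sigma^{i-1}, where h_i has z-degree < d
   and  c z^k . m = c m (phi*_theta)^k *)
Definition iota_h (q r d : nat) (theta : K) (A : nat -> tser K s)
  (h : 'I_r -> zser) : tpol := fun n nu =>
  \sum_(i < r) \sum_(k < d)
     tmul (h i k) (tpmul q (sigpow i) (tppow q (phistar q r theta A) k) n) nu.

Definition delta1 (q N : nat) (P : tpol) : tser K s := fun nu =>
  \sum_(n < N) tw q (n%:Z) (P n nu).

End TateOps.

(* Main.v *)
(* Put [u := g_r^(-1) / A_r^(-r)].  Eliminating [g_2, .., g_r] from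
   [g^(-1) Phi - g = h] leaves [g_1 + h_1 = (z - theta) u] and
   [z u = phi_theta(u) + H] with [H = sum_i h_i^(i-1)], where [phi_theta] acts
   coefficientwise in [z].  The first relation makes [xi] telescope to
   [lim - theta^n u_(n-1)].  Since [delta_1] turns right multiplication by
   [phi_theta^*] into [phi_theta], one has
   [Xi = sum_k phi_theta^k(H_k) = - phi_theta^d(u_(d-1))].
   It remains to see that [exp(theta^-n xi) = - u_(n-1)] for [n >= d].  The sum
   [v_n] of both terms satisfies [phi_theta(v_(n+1)) = v_n] and
   [|v_n| = o(q^-n)]; as [|phi_theta(x)| <= q |x|] for small [x], this
   forces [v_n = 0]. *)
Require Import Defs.
From HB Require Import structures.
From mathcomp Require Import all_boot all_order all_algebra.
From mathcomp Require Import reals.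
From mathcomp Require Import pgroup abelian finfield boolp.
From mathcomp Require Import zify ring lra.
Import Order.TTheory GRing.Theory Num.Theory.
Local Open Scope ring_scope.

(** * The ring of power series in several variables *)

(** An inverse of the exponential is available only near 0, whereas [xi] may be large. Dividing by
    [theta^n] moves the argument close to 0, and there a direct estimate replaces the logarithm:
    every term of [exp] after the first involves a power [q^i >= 2], so [exp(x) - x] is quadratic in
    [x]. At [x = theta^-n xi] this error is [O(q^-2n)]. The rest of [v_n], namely
    [theta^-n xi + u_(n-1)], is [theta^-n] times the error in the limit defining [xi]. Both are
    [o(q^-n)]. The range [n >= d] is where [H_n] vanishes, so that [u_(n-1) = phi_theta(u_n)]
    exactly. The algebra takes place in the ring of all formal power series in the [t_i], on which
    the Frobenius twist is a ring endomorphism. The Gauss norm enters through uniform bounds on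
    coefficients; limits are taken coefficientwise in [K], and their uniformity is read off these
    bounds. *)

Section MultiIndices.
Variable s : nat.
Implicit Types mu nu la : midx s.

Definition mle mu nu : bool := [forall i, (mu i <= nu i)%N].
Definition maddn mu nu : midx s := [ffun i => (mu i + nu i)%N].
Definition msubn mu nu : midx s := [ffun i => (mu i - nu i)%N].

(** The index type of the sum in [tmul] depends on [nu]. Listing the indices in the fixed type
    [midx s] lets the ring axioms be proved by permuting lists. *)
Definition below nu : seq (midx s) :=
  [seq [ffun i => nat_of_ord ((a : {ffun 'I_s -> 'I_(mdeg nu).+1}) i)]
     | a <- enum [pred a : {ffun 'I_s -> 'I_(mdeg nu).+1} |
                     [forall i, (a i <= nu i)%N]]].

Lemma below_uniq nu : uniq (below nu).
Proof.
rewrite map_inj_uniq ?enum_uniq // => a b /ffunP E.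
by apply/ffunP => i; apply: val_inj; have := E i; rewrite !ffunE.
Qed.

Lemma mem_below nu mu : (mu \in below nu) = mle mu nu.
Proof.
apply/mapP/forallP => [[a] | H].
  by rewrite mem_enum inE => /forallP Ha -> i; rewrite ffunE.
have lt i : (mu i < (mdeg nu).+1)%N.
  by rewrite ltnS (leq_trans (H i)) // /mdeg (bigD1 i) //= leq_addr.
exists [ffun i => Ordinal (lt i)]; last by apply/ffunP => i; rewrite !ffunE.
by rewrite mem_enum inE; apply/forallP => i; rewrite ffunE /= H.
Qed.

Lemma mleP mu nu : reflect (forall i, (mu i <= nu i)%N) (mle mu nu).
Proof. exact: forallP. Qed.

Lemma msubK mu nu : mle mu nu -> msubn nu (msubn nu mu) = mu.
Proof. by move/mleP=> H; apply/ffunP => i; rewrite !ffunE subKn. Qed.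

Lemma mle_sub mu nu : mle (msubn nu mu) nu.
Proof. by apply/mleP => i; rewrite ffunE leq_subr. Qed.

Lemma below_sub_perm nu : perm_eq (below nu) (map (msubn nu) (below nu)).
Proof.
apply: uniq_perm; first exact: below_uniq.
  rewrite map_inj_in_uniq ?below_uniq // => a b; rewrite !mem_below => Ha Hb E.
  by rewrite -(msubK _ _ Ha) E msubK.
move=> mu; rewrite mem_below; apply/idP/mapP => [H | [a _ ->]].
  by exists (msubn nu mu); rewrite ?mem_below ?mle_sub // msubK.
exact: mle_sub.
Qed.

Lemma below_add_perm nu la : mle la nu ->
  perm_eq [seq mu <- below nu | mle la mu]
          (map (maddn la) (below (msubn nu la))).
Proof.
move/mleP => Hl; apply: uniq_perm.
- by rewrite filter_uniq // below_uniq.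
- rewrite map_inj_uniq ?below_uniq // => a b /ffunP E.
  by apply/ffunP => i; have := E i; rewrite !ffunE => /addnI.
move=> mu; rewrite mem_filter mem_below; apply/andP/mapP.
  case=> /mleP H1 /mleP H2; exists (msubn mu la).
    rewrite mem_below; apply/mleP => i; rewrite !ffunE leq_sub2r //.
  by apply/ffunP => i; rewrite !ffunE subnKC.
case=> a; rewrite mem_below => /mleP Ha ->; split; apply/mleP => i.
  by rewrite ffunE leq_addr.
by have := Ha i; have := Hl i; rewrite !ffunE; lia.
Qed.

End MultiIndices.

(** * Commutative ring structure on formal power series *)

Section TateRing.
Variables (K : closedFieldType) (s : nat).
Local Notation T := (tser K s).
Implicit Types (f g h : T) (nu mu : midx s).

Lemma tmulE f g nu : tmul f g nu = \sum_(mu <- below _ nu) f mu * g (msubn _ nu mu).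
Proof.
rewrite /tmul /below big_map big_enum_cond /=.
apply: eq_big => mu; first by rewrite inE andbT.
by move=> _; congr (_ * g _); apply/ffunP => i; rewrite !ffunE.
Qed.

Lemma tmulC : commutative (@tmul K s).
Proof.
move=> f g; apply: funext => nu; rewrite !tmulE (perm_big _ (below_sub_perm _ nu)).
rewrite big_map big_seq [RHS]big_seq; apply: eq_bigr => mu.
by rewrite mem_below => H; rewrite msubK // mulrC.
Qed.

Lemma tmulA : associative (@tmul K s).
Proof.
move=> f g h; apply: funext => nu; rewrite !tmulE.
(* Both triple products are sums over chains [la <= mu <= nu]; summing over [la] first gives one
   bracketing, over [mu] first the other. *)
transitivity (\sum_(mu <- below _ nu) \sum_(la <- below _ nu | mle _ la mu)
    f la * g (msubn _ mu la) * h (msubn _ nu mu)); last first.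
  rewrite big_seq [RHS]big_seq; apply: eq_bigr => mu; rewrite mem_below => Hmu.
  rewrite tmulE mulr_suml -big_filter; apply: perm_big.
  apply: uniq_perm; rewrite ?filter_uniq ?below_uniq //.
  move=> la; rewrite mem_filter !mem_below; case: (mleP _ la mu) => //= H.
  by apply/mleP => i; apply: leq_trans (H i) _; move/mleP: Hmu.
rewrite (exchange_big_dep xpredT) //= big_seq [RHS]big_seq.
apply: eq_bigr => la; rewrite mem_below => Hla.
rewrite tmulE mulr_sumr -[RHS]big_filter (perm_big _ (below_add_perm _ _ _ Hla)).
rewrite [RHS]big_map; apply: eq_bigr => mu _; rewrite mulrA.
by congr (_ * g _ * h _); apply/ffunP => i; rewrite !ffunE ?addKn ?subnDA.
Qed.

Lemma tmul_constl c f nu : tmul (tconst c) f nu = c * f nu.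
Proof.
rewrite tmulE (bigD1_seq (mzero s)) ?below_uniq //=; last first.
  by rewrite mem_below; apply/mleP => i; rewrite ffunE.
rewrite {1}/tconst eqxx big1 ?addr0 => [|mu /negPf H]; last first.
  by rewrite /tconst H mul0r.
by congr (_ * f _); apply/ffunP => i; rewrite !ffunE subn0.
Qed.

Definition tadd f g : T := fun nu => f nu + g nu.
Definition topp f : T := fun nu => - f nu.

Lemma taddA : associative tadd.
Proof. by move=> f g h; apply: funext => nu; rewrite /tadd addrA. Qed.
Lemma taddC : commutative tadd.
Proof. by move=> f g; apply: funext => nu; rewrite /tadd addrC. Qed.
Lemma tadd0 : left_id (@tzero K s) tadd.
Proof. by move=> f; apply: funext => nu; rewrite /tadd add0r. Qed.
Lemma taddN : left_inverse (@tzero K s) topp tadd.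
Proof. by move=> f; apply: funext => nu; rewrite /tadd /topp addNr. Qed.
Lemma tmul1 : left_id (@tone K s) (@tmul K s).
Proof. by move=> f; apply: funext => nu; rewrite tmul_constl mul1r. Qed.
Lemma tmulD : left_distributive (@tmul K s) tadd.
Proof.
move=> f g h; apply: funext => nu; rewrite /tadd !tmulE -big_split /=.
by apply: eq_bigr => mu _; rewrite mulrDl.
Qed.
Lemma tone_neq0 : @tone K s <> @tzero K s.
Proof.
move/(congr1 (fun f => f (mzero s))); rewrite /tone /tconst eqxx => /eqP.
by rewrite oner_eq0.
Qed.

HB.instance Definition _ := gen_eqMixin T.
HB.instance Definition _ := gen_choiceMixin T.
HB.instance Definition _ := GRing.isZmodule.Build T taddA taddC tadd0 taddN.
HB.instance Definition _ :=
  GRing.Zmodule_isComNzRing.Build T tmulA tmulC tmul1 tmulD (introN eqP tone_neq0).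

Lemma tser0E nu : (0 : T) nu = 0. Proof. by []. Qed.
Lemma tserME f g nu :
  (f * g : T) nu = \sum_(mu <- below _ nu) f mu * g (msubn _ nu mu).
Proof. exact: tmulE. Qed.
Lemma tconstME c f nu : (tconst c * f : T) nu = c * f nu.
Proof. exact: tmul_constl. Qed.
Lemma tserDE f g nu : (f + g : T) nu = f nu + g nu. Proof. by []. Qed.
Lemma tserNE f nu : (- f : T) nu = - f nu. Proof. by []. Qed.
Lemma tser_sumE (I : Type) (r : seq I) (P : pred I) (F : I -> T) nu :
  (\sum_(i <- r | P i) F i) nu = \sum_(i <- r | P i) F i nu.
Proof. by elim/big_ind2: _ => // _ x _ y <- <-. Qed.

End TateRing.

(** * Twisted power series and their action *)

Section Twisted.
Variables (T : comNzRingType) (fr : {rmorphism T -> T}).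

Definition frob_iter (n : nat) (x : T) : T := iter n fr x.
Arguments frob_iter : simpl never.

Lemma frn_zmod n : zmod_morphism (frob_iter n).
Proof.
by elim: n => // n IH x y; rewrite /frob_iter /= -!/(frob_iter _ _) IH rmorphB.
Qed.
Lemma frn_monoid n : monoid_morphism (frob_iter n).
Proof.
elim: n => // n [IH1 IHM]; split=> [|x y]; rewrite /frob_iter /= -!/(frob_iter _ _).
  by rewrite IH1 rmorph1.
by rewrite IHM rmorphM.
Qed.
HB.instance Definition _ n :=
  GRing.isZmodMorphism.Build T T (frob_iter n) (frn_zmod n).
HB.instance Definition _ n :=
  GRing.isMonoidMorphism.Build T T (frob_iter n) (frn_monoid n).

Lemma frnD m n x : frob_iter (m + n) x = frob_iter m (frob_iter n x).
Proof. exact: iterD. Qed.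
Lemma frnSr n x : frob_iter n.+1 x = frob_iter n (fr x). Proof. exact: iterSr. Qed.

(* [tau_act c N x] is the action on [x] of the truncation at order [N] of the
   twisted power series [sum_i c_i tau^i]. *)
Definition tau_act (c : nat -> T) (N : nat) (x : T) :=
  \sum_(i < N) c i * frob_iter i x.

Lemma actS c N x : tau_act c N.+1 x = tau_act c N x + c N * frob_iter N x.
Proof. by rewrite /tau_act big_ord_recr. Qed.

Lemma act_zmod c N : zmod_morphism (tau_act c N).
Proof.
by move=> x y; rewrite /tau_act -sumrB; apply: eq_bigr => i _; rewrite rmorphB mulrBr.
Qed.
HB.instance Definition _ c N :=
  GRing.isZmodMorphism.Build T T (tau_act c N) (act_zmod c N).

(** The product of twisted power series, with [tau f = f^(1) tau]. *)
Definition tau_mul (P Q : nat -> T) (n : nat) :=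
  \sum_(j < n.+1) P j * frob_iter j (Q (n - j)%N).

Lemma sum_shift (f : nat -> T) j N :
  \sum_(n < N | (j <= n)%N) f (n - j)%N = \sum_(n < N - j) f n.
Proof.
elim: N => [|N IH]; first by rewrite sub0n !big_ord0.
rewrite big_mkcond big_ord_recr /= -big_mkcond /= IH.
case: leqP => H; first by rewrite subSn // big_ord_recr.
by rewrite addr0 (eqP (ltnW H : N - j == 0)%N) (eqP (H : N.+1 - j == 0)%N).
Qed.

(** In a product cut at order [N], the term [P j tau^j] meets [Q] only up to order [N - j]. With
    these shifted cut-offs the identity is exact, and the number of summands on the right stays
    fixed as [N] grows, so limits can be taken summand by summand. *)
Lemma act_tau_mul P Q r N x : (forall j, (r < j)%N -> P j = 0) ->
  tau_act (tau_mul P Q) N x = \sum_(j < r.+1) P j * frob_iter j (tau_act Q (N - j) x).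
Proof.
move=> HP.
transitivity (\sum_(n < N) \sum_(j < r.+1 | (j <= n)%N)
    P j * frob_iter j (Q (n - j)%N * frob_iter (n - j) x)).
  apply: eq_bigr => n _; rewrite /tau_mul mulr_suml.
  rewrite (eq_bigr (fun j : 'I_n.+1 =>
    P j * frob_iter j (Q (n - j)%N * frob_iter (n - j) x))).
    (* Replaces the range [j <= n] by one independent of [n], as the exchange of sums requires; both
       are compared inside a common larger range. *)
    have E m2 (G : nat -> T) : (forall j, (r < j)%N -> G j = 0) -> (r < m2)%N ->
        \sum_(j < n.+1) G j = \sum_(j < m2 | (j <= n)%N) G j.
      move=> HG Hm; rewrite -(big_mkord xpredT).
      rewrite -(big_mkord (fun j => (j <= n)%N)).
      rewrite (big_nat_widen _ _ (maxn n.+1 m2)) ?leq_maxl //.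
      rewrite [RHS](big_nat_widen _ _ (maxn n.+1 m2)) ?leq_maxr //.
      rewrite [LHS]big_mkcond [RHS]big_mkcond; apply: eq_bigr => j _ /=.
      rewrite ltnS; case: (j <= n)%N => //=; case: ltnP => // Hj.
      by apply: HG; apply: leq_trans Hj.
    rewrite (E r.+1 (fun j =>
      P j * frob_iter j (Q (n - j)%N * frob_iter (n - j) x))) //.
    by move=> j Hj; rewrite HP // mul0r.
  by move=> j _; rewrite rmorphM /= -frnD subnKC ?mulrA // -ltnS.
rewrite (exchange_big_dep xpredT) //=; apply: eq_bigr => j _.
rewrite -mulr_sumr -raddf_sum; congr (_ * frob_iter _ _).
exact: (sum_shift (fun m => Q m * frob_iter m x)).
Qed.

End Twisted.

Arguments frob_iter : simpl never.

(** * Elimination in the linear system, and passage from sigma to tau *)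

Section DrinfeldAlgebra.
Variables (T : comNzRingType) (fr : {rmorphism T -> T}) (fri : T -> T).
Hypothesis friK : cancel fri fr.
Variables (th : T) (A : nat -> T) (r : nat).
Local Notation frn := (frob_iter T fr).
Local Notation act := (tau_act T fr).
Local Notation twmul := (tau_mul T fr).

Definition frin (n : nat) (x : T) : T := iter n fri x.
Arguments frin : simpl never.

Lemma frinK n : cancel (frin n) (frn n).
Proof.
elim: n => // n IH x; rewrite -[frin _ _]/(fri (frin n x)).
by rewrite frnSr friK IH.
Qed.

Definition phi_coef (j : nat) : T :=
  if j == 0%N then th else if (j <= r)%N then A j else 0.

Definition phi_op (x : T) : T := act phi_coef r.+1 x.

Lemma phi_coef_gt j : (r < j)%N -> phi_coef j = 0.
Proof. by case: j => // j; rewrite /phi_coef /= ltnNge => /negPf ->. Qed.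

Lemma phi_zmod : zmod_morphism phi_op. Proof. exact: act_zmod. Qed.
HB.instance Definition _ := GRing.isZmodMorphism.Build T T phi_op phi_zmod.

Lemma phiE x : phi_op x = th * x + \sum_(j < r) A j.+1 * frn j.+1 x.
Proof.
rewrite /phi_op /tau_act big_ord_recl; congr (_ + _); apply: eq_bigr => j _.
by rewrite /phi_coef /= /bump /= add1n ltn_ord.
Qed.

(* Eliminating [g_1, .., g_{r-1}] from the system [g^(-1) Phi - g = h]. *)
Lemma phi_of_system (g h : nat -> T) (p v : T) : (0 < r)%N ->
  g 0%N + h 0%N = p - th * v ->
  (forall j, (j.+1 < r)%N ->
     g j.+1 + h j.+1 = fri (g j) - frin j.+1 (A j.+1) * v) ->
  fri (g r.-1) = frin r (A r) * v ->
  p = phi_op v + \sum_(i < r) frn i (h i).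
Proof.
move=> r0 E0 Ej Er.
(* Twisting the equation for [g j.+1] by [j.+1] turns [fri (g j)] into [frn j (g j)] and frees
   [A j.+1] of its twist, so each equation contributes one more term of [phi v] and of the sum of
   the [h i]. *)
have H j : (j < r)%N ->
    frn j (g j) = p - act phi_coef j.+1 v - \sum_(i < j.+1) frn i (h i).
  elim: j => [_|j IH Hj].
    rewrite /tau_act !big_ord_recl !big_ord0 !addr0.
    by change (g 0%N = p - th * v - h 0%N); rewrite -E0 addrK.
  have := congr1 (frn j.+1) (Ej _ Hj).
  rewrite rmorphD rmorphB rmorphM /= frinK.
  rewrite [frn j.+1 (fri _)]frnSr friK (IH (ltnW Hj)) => E.
  rewrite actS [\sum_(i < j.+2) _]big_ord_recr /= {2}/phi_coef /= (ltnW Hj).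
  rewrite -[LHS](addrK (frn j.+1 (h j.+1))) E; ring.
have := congr1 (frn r) Er; rewrite rmorphM /= frinK.
rewrite -[X in frn X]prednK // frnSr friK H ?prednK // => E.
rewrite /phi_op actS {2}/phi_coef leqnn gtn_eqF // -E; ring.
Qed.

Definition sigma_mul (P Q : nat -> T) (n : nat) : T :=
  \sum_(m < n.+1) P m * frin m (Q (n - m)%N).
(** The adjoint, sending [a sigma^n] to [tau^n a = a^(n) tau^n]. It reverses products, and
    [delta_1(x Q)] is the adjoint of [Q] acting on [x]. *)
Definition tau_of_sigma (Q : nat -> T) (n : nat) : T := frn n (Q n).
Definition sigma_one (k : nat) : T := if k == 0%N then 1 else 0.
Definition sigma_exp (P : nat -> T) (k : nat) :=
  iter k (fun Q => sigma_mul Q P) sigma_one.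

(* [delta_1] turns right multiplication in T[sigma] into the action of T[tau]. *)
Lemma tau_of_sigma_mul P Q :
  tau_of_sigma (sigma_mul Q P) = twmul (tau_of_sigma P) (tau_of_sigma Q).
Proof.
apply: funext => n; rewrite /tau_of_sigma /sigma_mul /tau_mul rmorph_sum.
rewrite (reindex_inj rev_ord_inj) /=; apply: eq_bigr => j _.
have Hj : (j <= n)%N by rewrite -ltnS.
rewrite rmorphM /= subSS subKn // -frnD subnKC // mulrC; congr (_ * _).
by rewrite -{1}(subnKC Hj) frnD frinK.
Qed.

Variable ps : nat -> T.
Hypothesis tilde_ps : tau_of_sigma ps = phi_coef.

Lemma tau_of_sigma_one : tau_of_sigma sigma_one = sigma_one.
Proof.
by apply: funext => -[|n]; rewrite /tau_of_sigma /sigma_one ?rmorph1 ?rmorph0.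
Qed.

Lemma tau_of_sigma_expS k :
  tau_of_sigma (sigma_exp ps k.+1) = twmul phi_coef (tau_of_sigma (sigma_exp ps k)).
Proof. by rewrite /sigma_exp /= tau_of_sigma_mul tilde_ps. Qed.

Lemma sigma_exp_support k j : (r * k < j)%N -> tau_of_sigma (sigma_exp ps k) j = 0.
Proof.
elim: k j => [|k IH] j.
  by rewrite muln0 [sigma_exp _ _]/= tau_of_sigma_one; case: j.
rewrite mulnS tau_of_sigma_expS /tau_mul => Hj; apply: big1 => i _.
case: (leqP i r) => Hi; last by rewrite phi_coef_gt // mul0r.
by rewrite IH ?rmorph0 ?mulr0 //; lia.
Qed.

Lemma act_sigma_exp k N x : (r * k < N)%N ->
  act (tau_of_sigma (sigma_exp ps k)) N x = iter k phi_op x.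
Proof.
elim: k N => [|k IH] N HN.
  rewrite [sigma_exp _ _]/= tau_of_sigma_one /tau_act; case: N HN => // N _.
  rewrite big_ord_recl /= mul1r big1 ?addr0 // => i _.
  by rewrite /sigma_one /= mul0r.
rewrite tau_of_sigma_expS (act_tau_mul _ _ _ _ r); last exact: phi_coef_gt.
rewrite iterS {2}/phi_op; apply: eq_bigr => j _; rewrite IH //.
by have := ltn_ord j; lia.
Qed.

Definition sigma_pow (i n : nat) : T := if n == i then 1 else 0.

Lemma act_sigma_pow i N x : (i < N)%N -> act (sigma_pow i) N x = frn i x.
Proof.
move=> Hi; rewrite /tau_act (bigD1 (Ordinal Hi)) //= /sigma_pow eqxx mul1r.
rewrite big1 ?addr0 //.
by move=> j; rewrite -val_eqE /= => /negPf ->; rewrite mul0r.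
Qed.

(** The sigma-degree here is at most [i + r * k], so the cut at [N] loses nothing. The adjoint
    reverses the product, hence [x] is first twisted [i] times and only then moved by [phi_op]. *)
Lemma delta1_sigma_exp i k N x : (i + r * k < N)%N ->
  \sum_(n < N) frn n (x * sigma_mul (sigma_pow i) (sigma_exp ps k) n)
  = iter k phi_op (frn i x).
Proof.
move=> HN.
have Es : tau_of_sigma (sigma_pow i) = sigma_pow i.
  apply: funext => n; rewrite /tau_of_sigma /sigma_pow.
  by case: eqP; rewrite ?rmorph1 ?rmorph0.
transitivity (act (twmul (tau_of_sigma (sigma_exp ps k)) (sigma_pow i)) N x).
  apply: eq_bigr => n _; rewrite rmorphM /= mulrC; congr (_ * _).
  by rewrite -[RHS](congr1 (fun f => twmul _ f n) Es) -tau_of_sigma_mul.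
rewrite (act_tau_mul _ _ _ _ (r * k)) => [|j]; last exact: sigma_exp_support.
rewrite -(act_sigma_exp k (r * k).+1) // /tau_act; apply: eq_bigr => j _.
by congr (_ * frn _ _); rewrite -/(act _ _ _) act_sigma_pow //; have := ltn_ord j; lia.
Qed.

(** Additivity of [phi_op] turns the [k]-th summand into the difference of [iter k phi_op (p k)] and
    its successor. *)
Lemma iter_phi_telescope (p H : nat -> T) d :
  (forall k, p k = phi_op (p k.+1) + H k) ->
  \sum_(k < d) iter k phi_op (H k) = p 0%N - iter d phi_op (p d).
Proof.
have phiB k x y : iter k phi_op (x - y) = iter k phi_op x - iter k phi_op y.
  by elim: k => // k IH; rewrite !iterS IH raddfB.
move=> E; elim: d => [|d IH]; first by rewrite big_ord0 subrr.
rewrite big_ord_recr /= IH (_ : H d = p d - phi_op (p d.+1)).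
  by rewrite phiB -iterSr addrA subrK.
by rewrite {1}(E d) addrAC subrr add0r.
Qed.

End DrinfeldAlgebra.

(** * Gauss norm estimates and the exponential *)

Section Frobenius.
Variables (K : closedFieldType) (s q : nat).
Local Notation T := (tser K s).
Hypothesis q_pchar : [pchar K].-nat q.

Lemma q_gt0 : (0 < q)%N. Proof. by case/andP: q_pchar. Qed.

Lemma expqB (x y : K) : (x - y) ^+ q = x ^+ q - y ^+ q.
Proof.
apply/eqP; rewrite eq_sym subr_eq -exprDn_pchar // subrK //.
Qed.

Lemma qrootK (x : K) : qroot q x ^+ q = x.
Proof.
have /eqP := xchooseP (root_ex q.-1 x).
by rewrite -/(qroot q x) prednK // q_gt0.
Qed.

(* The unused hypothesis lets the morphism instances below be inferred. *)
Definition tfr of [pchar K].-nat q := @ttw K s q 1.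
Local Notation fr := (tfr q_pchar).
Local Notation fri := (@ttw K s q (-1)).

Lemma tfrE f nu : fr f nu = f nu ^+ q. Proof. by []. Qed.

Lemma tfr_zmod : zmod_morphism fr.
Proof. by move=> f g; apply: funext => nu; rewrite !tfrE expqB. Qed.

Lemma tfr_monoid : monoid_morphism fr.
Proof.
split=> [|f g]; apply: funext => nu; rewrite tfrE.
  rewrite /GRing.one /= /tone /tconst; case: eqP => _; first by rewrite expr1n.
  by rewrite expr0n; have := q_gt0; case: (q).
rewrite !tserME.
elim/big_ind2: _ => [|x x' y y' <- <-|mu _].
- by rewrite expr0n; have := q_gt0; case: (q).
- by rewrite exprDn_pchar.
- by rewrite exprMn.
Qed.
End Frobenius.

HB.instance Definition _ (K : closedFieldType) s q (H : [pchar K].-nat q) :=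
  GRing.isZmodMorphism.Build (tser K s) (tser K s) (@tfr K s q H) (tfr_zmod K s q H).
HB.instance Definition _ (K : closedFieldType) s q (H : [pchar K].-nat q) :=
  GRing.isMonoidMorphism.Build (tser K s) (tser K s) (@tfr K s q H)
    (tfr_monoid K s q H).

Section FrobeniusIter.
Variables (K : closedFieldType) (s q : nat).
Local Notation T := (tser K s).
Hypothesis q_pchar : [pchar K].-nat q.
Local Notation fr := (tfr K s q q_pchar).
Local Notation fri := (@ttw K s q (-1)).

Lemma tfriK : cancel fri fr.
Proof. by move=> f; apply: funext => nu; apply: qrootK q_pchar _. Qed.

Lemma ttw_pos n f : ttw q n%:Z f = frob_iter T fr n f.
Proof.
apply: funext => nu; elim: n => // n IH.
exact: (congr1 (fun x => x ^+ q) IH).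
Qed.

Lemma ttw_neg n f : ttw q (- n%:Z) f = frin T fri n f.
Proof.
apply: funext => nu; case: n => // n; rewrite -NegzE.
elim: n => // n IH.
have -> : ttw q (Negz n.+1) f nu = qroot q (ttw q (Negz n) f nu) by [].
by rewrite IH.
Qed.

Lemma frnE n f nu : frob_iter T fr n f nu = f nu ^+ (q ^ n).
Proof.
elim: n => [|n IH]; first by rewrite expn0 expr1.
have -> : frob_iter T fr n.+1 f nu = frob_iter T fr n f nu ^+ q by [].
by rewrite IH -exprM expnSr.
Qed.
End FrobeniusIter.

(** * Ultrametric bounds and uniform limits *)

Section NonArch.
Variables (R : realType) (K : closedFieldType) (nrm : K -> R).
Hypothesis nrm_ge0 : forall x, 0 <= nrm x.
Hypothesis nrm_eq0 : forall x, nrm x = 0 <-> x = 0.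
Hypothesis nrmM : forall x y, nrm (x * y) = nrm x * nrm y.
Hypothesis nrmD : forall x y, nrm (x + y) <= Num.max (nrm x) (nrm y).

Lemma nrm0 : nrm 0 = 0. Proof. exact/nrm_eq0. Qed.

Lemma nrm1 : nrm 1 = 1.
Proof.
have n1 : nrm 1 != 0 by apply/eqP => /nrm_eq0/eqP; rewrite oner_eq0.
by apply: (mulfI n1); rewrite -nrmM !mulr1.
Qed.

Lemma nrmX x n : nrm (x ^+ n) = nrm x ^+ n.
Proof. by elim: n => [|n IH]; rewrite ?expr0 ?nrm1 // !exprS nrmM IH. Qed.

Lemma nrmN x : nrm (- x) = nrm x.
Proof.
have n1 : nrm (-1) = 1.
  apply/eqP; rewrite -(@eqrXn2 _ 2) ?nrm_ge0 // -nrmX sqrrN expr1n.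
  by rewrite nrm1 expr1n.
by rewrite -mulN1r nrmM n1 mul1r.
Qed.

Lemma nrmD_le x y B : nrm x <= B -> nrm y <= B -> nrm (x + y) <= B.
Proof. by move=> hx hy; apply: le_trans (nrmD x y) _; rewrite ge_max hx hy. Qed.

Lemma nrm_sum (I : Type) (r : seq I) (P : pred I) (F : I -> K) B :
  0 <= B -> (forall i, P i -> nrm (F i) <= B) -> nrm (\sum_(i <- r | P i) F i) <= B.
Proof.
move=> B0 HF; elim/big_ind: _ => //; first by rewrite nrm0.
by move=> x y; apply: nrmD_le.
Qed.

Variable s : nat.
Local Notation T := (tser K s).

(* The Gauss norm of [x] is at most [B]. *)
Definition nb (x : T) (B : R) : Prop := forall nu, nrm (x nu) <= B.
Definition bounded (x : T) : Prop := exists B, nb x B.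

Lemma nb_ge0 x B : nb x B -> 0 <= B.
Proof. by move/(_ (mzero s)); apply: le_trans. Qed.
Lemma nb_le x B C : B <= C -> nb x B -> nb x C.
Proof. by move=> h H nu; apply: le_trans (H nu) h. Qed.
Lemma nbD x y B : nb x B -> nb y B -> nb (x + y) B.
Proof. by move=> hx hy nu; apply: nrmD_le. Qed.
Lemma nbN x B : nb x B -> nb (- x) B.
Proof. by move=> hx nu; rewrite tserNE nrmN. Qed.
Lemma nbB x y B : nb x B -> nb y B -> nb (x - y) B.
Proof. by move=> hx hy; apply: nbD => //; apply: nbN. Qed.
Lemma nb0 B : 0 <= B -> nb 0 B.
Proof. by move=> h nu; rewrite tser0E nrm0. Qed.
Lemma nb_sum (I : Type) (r : seq I) (P : pred I) (F : I -> T) B :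
  0 <= B -> (forall i, P i -> nb (F i) B) -> nb (\sum_(i <- r | P i) F i) B.
Proof. by move=> B0 H nu; rewrite tser_sumE; apply: nrm_sum => // i /H. Qed.
Lemma nbM x y B C : nb x B -> nb y C -> nb (x * y) (B * C).
Proof.
move=> hx hy nu; rewrite tserME; apply: nrm_sum => [|mu _].
  by rewrite mulr_ge0 // (nb_ge0 _ _ hx, nb_ge0 _ _ hy).
by rewrite nrmM ler_pM.
Qed.
Lemma nb_constM c x B : nb x B -> nb (tconst c * x) (nrm c * B).
Proof.
by move=> hx nu; rewrite tconstME nrmM ler_wpM2l.
Qed.
Lemma nb_eq0 x : (forall e, 0 < e -> nb x e) -> x = 0.
Proof.
move=> H; apply: funext => nu; apply/nrm_eq0/eqP; rewrite eq_le nrm_ge0 andbT.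
by apply/ler_addgt0Pl => e e0; rewrite addr0; apply: H.
Qed.

Lemma bounded_max x y : bounded x -> bounded y ->
  exists B, [/\ 1 <= B, nb x B & nb y B].
Proof.
move=> [B hB] [C hC]; exists (Num.max 1 (Num.max B C)).
by split; [ | apply: nb_le hB | apply: nb_le hC]; rewrite !le_max lexx ?orbT.
Qed.

(** Coefficients of degree at least [N] have norm below 1; the others have indices in a finite box,
    where the sum of all norms bounds each one. *)
Lemma tate_bounded x : tate nrm x -> bounded x.
Proof.
move=> /(_ 1 ltr01) [N HN].
pose c (a : {ffun 'I_s -> 'I_N}) : midx s := [ffun i => nat_of_ord (a i)].
have S0 : 0 <= \sum_a nrm (x (c a)) by apply: sumr_ge0 => a _.
exists (1 + \sum_a nrm (x (c a))) => nu.
case: (leqP N (mdeg nu)) => [/HN/ltW h|h]; first by rewrite (le_trans h) // lerDl.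
have lt i : (nu i < N)%N.
  by apply: leq_ltn_trans h; rewrite /mdeg (bigD1 i) //= leq_addr.
have -> : nu = c [ffun i => Ordinal (lt i)].
  by apply/ffunP => i; rewrite !ffunE.
rewrite (bigD1 [ffun i => Ordinal (lt i)]) //= addrCA lerDl addr_ge0 //.
by apply: sumr_ge0 => a _.
Qed.

(** The non-strict inequality matches [nb]; [cv_tconv] recovers the strict form by halving the
    radius. *)
Definition cv (S : nat -> T) (L : T) : Prop :=
  forall e, 0 < e -> exists N, forall n, (N <= n)%N -> nb (S n - L) e.

Lemma cv_tconv S L : cv S L -> tconv nrm S L.
Proof.
move=> H e e0; have [|N HN] := H (e / 2); first by rewrite divr_gt0.
exists N => n /HN h nu; apply: le_lt_trans (h nu) _.
by rewrite ltr_pdivrMr // ltr_pMr // ltr1n.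
Qed.

Lemma cv_eq S S' L : (exists N, forall n, (N <= n)%N -> S n = S' n) -> cv S L -> cv S' L.
Proof.
move=> [N0 E] H e /H [N HN]; exists (maxn N N0) => n; rewrite geq_max => /andP[h1 h2].
by rewrite -E //; apply: HN.
Qed.

Lemma cv_unique S L L' : cv S L -> cv S L' -> L = L'.
Proof.
move=> H H'; apply/eqP; rewrite -subr_eq0; apply/eqP; apply: nb_eq0 => e e0.
have [N HN] := H e e0; have [N' HN'] := H' e e0.
have -> : L - L' = - (S (maxn N N') - L) + (S (maxn N N') - L') by ring.
apply: nbD; first by apply/nbN/HN; rewrite leq_maxl.
by apply: HN'; rewrite leq_maxr.
Qed.

Lemma cv_cst L : cv (fun=> L) L.
Proof. by move=> e e0; exists 0%N => n _; rewrite subrr; apply/nb0/ltW. Qed.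

Lemma cvD S S' L L' : cv S L -> cv S' L' -> cv (fun n => S n + S' n) (L + L').
Proof.
move=> H H' e e0; have [N HN] := H e e0; have [N' HN'] := H' e e0.
exists (maxn N N') => n; rewrite geq_max => /andP[h1 h2].
by rewrite opprD addrACA; apply: nbD; [apply: HN | apply: HN'].
Qed.

Lemma cv_sum (I : Type) (r : seq I) (S : I -> nat -> T) (L : I -> T) :
  (forall i, cv (S i) (L i)) ->
  cv (fun n => \sum_(i <- r) S i n) (\sum_(i <- r) L i).
Proof.
move=> H; elim: r => [|i r IH].
  rewrite big_nil; apply: cv_eq (cv_cst 0); exists 0%N => n _.
  by rewrite big_nil.
rewrite big_cons; apply: cv_eq (cvD _ _ _ _ (H i) IH).
by exists 0%N => n _; rewrite big_cons.
Qed.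

Lemma cvM a S L : bounded a -> cv S L -> cv (fun n => a * S n) (a * L).
Proof.
move=> ha H e e0; have [B [B1 hB _]] := bounded_max _ _ ha ha.
have B0 : 0 < B by apply: lt_le_trans B1.
have [|N HN] := H (e / B); first by rewrite divr_gt0.
exists N => n /HN h; rewrite -mulrBr.
by apply: nb_le (nbM _ _ _ _ hB h); rewrite mulrC divfK // gt_eqF.
Qed.

Lemma cv_shift j S L : cv S L -> cv (fun n => S (n - j)%N) L.
Proof. by move=> H e /H [N HN]; exists (N + j)%N => n h; apply: HN; lia. Qed.

Lemma cv_bound S L B N0 : (forall n, (N0 <= n)%N -> nb (S n) B) -> cv S L -> nb L B.
Proof.
move=> HS H nu; rewrite leNgt; apply/negP => lt.
have B0 : 0 <= B := nb_ge0 _ _ (HS _ (leqnn N0)).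
have [e [lt1 lt2]] : exists e, B < e /\ e < nrm (L nu).
  by exists ((nrm (L nu) + B) / 2); split; lra.
have [N HN] := H e (le_lt_trans B0 lt1).
pose n := maxn N N0; suff : nrm (L nu) <= e by rewrite leNgt lt2.
have -> : L nu = S n nu - (S n - L) nu by rewrite tserDE tserNE; ring.
apply: nrmD_le; last by rewrite nrmN; apply: HN; rewrite leq_maxl.
exact: le_trans (HS n (leq_maxr _ _) nu) (ltW lt1).
Qed.

Hypothesis complete : forall u : nat -> K,
  (forall eps : R, 0 < eps -> exists N, forall m n : nat,
     (N <= m)%N -> (N <= n)%N -> nrm (u m - u n) < eps) ->
  exists l, forall eps : R, 0 < eps -> exists N, forall n : nat,
     (N <= n)%N -> nrm (u n - l) < eps.

Lemma cv_series (f : nat -> T) :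
  (forall e, 0 < e -> exists N, forall i, (N <= i)%N -> nb (f i) e) ->
  exists L, cv (fun n => \sum_(i < n) f i) L.
Proof.
move=> Hf; pose S n := \sum_(i < n) f i.
have SB e N : 0 < e -> (forall i, (N <= i)%N -> nb (f i) e) ->
    forall n, (N <= n)%N -> nb (S n - S N) e.
  move=> e0 HN; elim=> [|n IH].
    by rewrite leqn0 => /eqP ->; rewrite subrr; apply/nb0/ltW.
  rewrite leq_eqVlt => /predU1P[->|h]; first by rewrite subrr; apply/nb0/ltW.
  by rewrite /S big_ord_recr /= addrAC; apply: nbD; [apply: IH | apply: HN].
have Scauchy e : 0 < e -> exists N, forall m n, (N <= m)%N -> (N <= n)%N ->
    nb (S m - S n) e.
  move=> e0; have [N HN] := Hf e e0; exists N => m n hm hn.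
  have -> : S m - S n = (S m - S N) - (S n - S N) by ring.
  by apply: nbB; apply: SB.
have /choice[L HL] : forall nu, exists l, forall eps : R, 0 < eps -> exists N,
    forall n : nat, (N <= n)%N -> nrm (S n nu - l) < eps.
  move=> nu; apply: complete => e e0.
  have [|N HN] := Scauchy (e / 2); first by rewrite divr_gt0.
  exists N => m n hm hn; apply: le_lt_trans (HN m n hm hn nu) _.
  by rewrite ltr_pdivrMr // ltr_pMr // ltr1n.
exists (L : T) => e e0; have [N HN] := Scauchy e e0; exists N => n hn nu.
(* The index [m] depends on [nu], but [N] and the bound [e] do not, so the coefficientwise limit is
   uniform. *)
have [N' HN'] := HL nu e e0; pose m := maxn N N'.
have -> : (S n - (L : T)) nu = (S n - S m) nu + (S m nu - L nu).
  by rewrite !tserDE !tserNE; ring.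
apply: nrmD_le; first by apply: HN => //; rewrite leq_maxl.
by apply/ltW/HN'; rewrite leq_maxr.
Qed.

Variable q : nat.
Hypothesis q_pchar : [pchar K].-nat q.
Local Notation frn := (frob_iter T (tfr K s q q_pchar)).

Lemma nb_frn n x B : nb x B -> nb (frn n x) (B ^+ (q ^ n)).
Proof.
move=> hx nu; rewrite frnE nrmX lerXn2r // nnegrE //.
exact: nb_ge0 hx.
Qed.

Lemma cv_frn n S L : cv S L -> cv (fun m => frn n (S m)) (frn n L).
Proof.
(* A radius at most 1 does not grow when raised to the power [q ^ n]. *)
move=> H e e0; have [|N HN] := H (Num.min 1 e); first by rewrite lt_min ltr01.
exists N => m /HN h; rewrite -rmorphB; apply: nb_le (nb_frn n _ _ h).
have m0 : 0 <= Num.min 1 e by rewrite le_min ler01 ltW.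
have m1 : Num.min 1 e <= 1 by rewrite ge_min lexx.
have -> : (q ^ n = (q ^ n).-1.+1)%N by rewrite prednK // expn_gt0 (q_gt0 _ _ q_pchar).
rewrite exprS; apply: (@le_trans _ _ (Num.min 1 e)).
  by rewrite ler_piMr // exprn_ile1.
by rewrite ge_min lexx orbT.
Qed.

Hypothesis q_gt1 : (1 < q)%N.
Variable theta : K.
Hypothesis nrm_theta : nrm theta = q%:R.
Local Notation fr := (tfr K s q q_pchar).
Local Notation th := (tconst theta : T).
Variables (r : nat) (A : nat -> T) (M : R).
Hypothesis r_gt0 : (0 < r)%N.
Hypothesis M_ge1 : 1 <= M.
Hypothesis nb_A : forall j, (1 <= j <= r)%N -> nb (A j) M.
Local Notation phi := (phi_op T fr th A r).
Local Notation coef := (phi_coef T th A r).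
Variable alpha : nat -> T.
Hypothesis alpha0 : alpha 0%N = 1.
Hypothesis alpha_rec :
  forall i, tconst (theta ^+ (q ^ i)) * alpha i = tau_mul T fr coef alpha i.
Local Notation exp := (tau_act T fr alpha).
Local Notation Q := (q%:R : R).

(** * Growth of the exponential, and rigidity of chains under phi *)

Lemma Q_gt1 : 1 < Q. Proof. by rewrite ltr1n. Qed.
Lemma Q_gt0 : 0 < Q. Proof. by apply: lt_trans Q_gt1. Qed.
Lemma M_gt0 : 0 < M. Proof. exact: lt_le_trans M_ge1. Qed.
Lemma Qn_gt0 n : 0 < Q ^+ n. Proof. by rewrite exprn_gt0 // Q_gt0. Qed.
Lemma Qn_ge1 n : 1 <= Q ^+ n. Proof. by rewrite exprn_ege1 // ltW // Q_gt1. Qed.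
Lemma leq_qX i : (i <= q ^ i)%N. Proof. by apply: ltnW; apply: ltn_expl. Qed.
Lemma qX_ge2 i : (0 < i)%N -> (2 <= q ^ i)%N.
Proof.
by move=> i0; apply: leq_trans q_gt1 _; rewrite -{1}(expn1 q) leq_exp2l.
Qed.

Lemma nb_A_frn j x B : (j < r)%N -> nb x B ->
  nb (A j.+1 * frn j.+1 x) (M * B ^+ (q ^ j.+1)).
Proof. by move=> Hj hx; apply: nbM; [apply: nb_A | apply: nb_frn]. Qed.

(* As [|theta^(q^i) - theta| = q^(q^i)], the recursion gives
   [q^(q^i) |alpha_i| <= max_j (M |alpha_(i-j)|^(q^j))]. *)
Lemma alpha_bound i : nb (alpha i) (M^-1 * (M / Q ^+ (i %/ r)) ^+ (q ^ i)).
Proof.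
have Mp := M_gt0.
elim/ltn_ind: i => -[|i] IH.
  rewrite alpha0 div0n expn0 !expr1 expr0 divr1 mulVf ?gt_eqF // => nu.
  rewrite /GRing.one /= /tone /tconst.
  by case: eqP => _; rewrite ?nrm1 ?nrm0.
set X := _ * _; pose D := Q ^+ (q ^ i.+1).
have X0 : 0 <= X.
  by rewrite mulr_ge0 ?invr_ge0 ?exprn_ge0 ?divr_ge0 ?ltW // Qn_gt0.
have D0 : 0 < D by exact: Qn_gt0.
pose rest := \sum_(j < i.+1) coef j.+1 * frn j.+1 (alpha (i - j)%N).
have Hrest : nb rest (D * X).
  apply: nb_sum => [|j _]; first by rewrite mulr_ge0 // ltW.
  case: (ltnP j r) => Hj; last first.
    by rewrite phi_coef_gt // mul0r; apply: nb0; rewrite mulr_ge0 // ltW.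
  rewrite /phi_coef /= Hj.
  have Hji : (j <= i)%N by rewrite -ltnS.
  have Hlt : (i - j < i.+1)%N by rewrite ltnS leq_subr.
  apply: nb_le (nb_A_frn _ _ _ Hj (IH _ Hlt)).
  (* The leading [M^-1] is there to absorb the bound [M] on [A j.+1]: its power [q ^ j.+1] is at
     least 2. Going back at most [r] indices lowers the quotient by [r] by at most 1, and the factor
     [D] pays for that. *)
  rewrite exprMn -exprM -expnD.
  have -> : (i - j + j.+1 = i.+1)%N by rewrite addnS subnK.
  rewrite mulrA /X mulrCA; apply: ler_pM.
  - by rewrite mulr_ge0 ?exprn_ge0 ?invr_ge0 // ltW.
  - by rewrite exprn_ge0 // divr_ge0 ?ltW // Qn_gt0.
  - case: (q ^ j.+1)%N (qX_ge2 j.+1 isT) => [|[|k]] // _.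
    have Mi0 : 0 <= M^-1 by rewrite invr_ge0 ltW.
    rewrite exprS mulrA mulfV ?gt_eqF // mul1r exprS ler_piMr // exprn_ile1 //.
    by rewrite invf_le1.
  have Q0 k : 0 <= Q ^+ k by apply/ltW/Qn_gt0.
  rewrite -exprMn; apply: lerXn2r.
  - by rewrite nnegrE divr_ge0 // ltW.
  - by rewrite nnegrE mulr_ge0 ?divr_ge0 // ltW // Q_gt0.
  rewrite mulrCA ler_wpM2l ?(ltW Mp) //.
  rewrite ler_pdivlMr ?Qn_gt0 // mulrC ler_pdivrMr ?Qn_gt0 // -exprS.
  rewrite ler_weXn2l ?ltW ?Q_gt1 //.
  have : (i.+1 <= i - j + r)%N by lia.
  move/(leq_div2r r)/leq_trans; apply.
  by rewrite divnDr ?dvdnn // divnn r_gt0 addn1.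
move=> nu; have := congr1 (fun f : T => nrm (f nu)) (alpha_rec i.+1).
rewrite /tau_mul big_ord_recl /=.
rewrite (_ : \sum_(_ < _) _ = rest); last first.
  by apply: eq_bigr => j _; rewrite /bump /= add1n subSS.
rewrite subn0 tserDE !tconstME nrmM nrmX nrm_theta -/D => E.
have := nrmD (theta * alpha i.+1 nu) (rest nu).
rewrite -{}E [nrm (theta * _)]nrmM nrm_theta le_max => /orP[h|h].
  (* As [D > Q], the term with [theta] can dominate only if this coefficient of [alpha] is 0. *)
  apply: le_trans X0; rewrite -(@pmulr_rle0 _ (D - Q)) ?mulrBl ?subr_le0 //.
  rewrite subr_gt0 /D -{1}(expr1 Q) ltr_eXn2l ?Q_gt1 //.
  by have := qX_ge2 _ (ltn0Sn i).
by rewrite -(ler_pM2l D0); apply: le_trans h (Hrest nu).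
Qed.

(** The divisor grows without bound, which gives convergence for every [rho]; for small [rho] the
    same estimate compares the exponential with the identity. *)
Lemma term_bound i x rho : nb x rho ->
  nb (alpha i * frn i x) ((M * rho / Q ^+ (i %/ r)) ^+ (q ^ i)).
Proof.
move=> hx; have rho0 := nb_ge0 _ _ hx; have Mp := M_gt0.
apply: nb_le (nbM _ _ _ _ (alpha_bound i) (nb_frn i _ _ hx)).
rewrite -[X in X <= _]mulrA -exprMn [M / _ * rho]mulrAC.
rewrite ler_piMl ?invf_le1 //; apply/exprn_ge0/divr_ge0; last exact/ltW/Qn_gt0.
by rewrite mulr_ge0 // ltW.
Qed.

Lemma term_small x : bounded x -> forall e, 0 < e ->
  exists N, forall i, (N <= i)%N -> nb (alpha i * frn i x) e.
Proof.
move=> [rho hx] e e0; have rho0 := nb_ge0 _ _ hx; have Mp := M_gt0.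
pose c := M * rho; have c0 : 0 <= c by rewrite mulr_ge0 // ltW.
(* For [i >= n * r] the base is at most 1/2, since [n <= q ^ (i %/ r)]; for [i >= n'] the power
   [2 ^ i] exceeds [e^-1]. *)
have [n Hn] : exists n : nat, 2 * c <= n%:R.
  by exists (Num.bound (2 * c)); apply/ltW/archi_boundP; rewrite mulr_ge0.
have [n' Hn'] : exists n : nat, e^-1 <= n%:R.
  by exists (Num.bound e^-1); apply/ltW/archi_boundP; rewrite invr_ge0 ltW.
exists (maxn (n * r) n') => i; rewrite geq_max => /andP[h1 h2].
apply: nb_le (term_bound i _ _ hx).
have Hc : c / Q ^+ (i %/ r) <= 2^-1.
  rewrite ler_pdivrMr ?Qn_gt0 // ler_pdivlMl //; apply: le_trans Hn _.
  rewrite -natrX ler_nat; apply: leq_trans (leq_qX (i %/ r)).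
  by rewrite leq_divRL.
apply: (@le_trans _ _ (2^-1 ^+ (q ^ i))).
  by rewrite lerXn2r // nnegrE ?invr_ge0 // divr_ge0 // (ltW (Qn_gt0 _)).
apply: (@le_trans _ _ (2^-1 ^+ i)).
  by rewrite ler_wiXn2l ?leq_qX ?invr_ge0 // invf_le1 // ler1n.
rewrite exprVn -[e]invrK lef_pV2 ?posrE ?invr_gt0 ?exprn_gt0 //.
apply: le_trans Hn' _; rewrite -natrX ler_nat (leq_trans h2) //.
by apply/ltnW/ltn_expl.
Qed.

Lemma exp_cv x : bounded x -> exists L, cv (exp ^~ x) L.
Proof. by move=> /term_small; apply: cv_series. Qed.

Lemma exp_near x rho L : nb x rho -> M * rho <= 1 -> cv (exp ^~ x) L ->
  nb (L - x) ((M * rho) ^+ 2).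
Proof.
move=> hx Hrho H; have rho0 := nb_ge0 _ _ hx; have Mp := M_gt0.
have c0 : 0 <= M * rho by rewrite mulr_ge0 // ltW.
apply: (cv_bound (fun n => exp n x - x) _ _ 1); last exact: cvD H (cv_cst (- x)).
move=> [//|n] _; rewrite /tau_act big_ord_recl alpha0 mul1r addrAC subrr add0r.
apply: nb_sum => [|i _]; first by rewrite exprn_ge0.
apply: nb_le (term_bound _ _ _ hx); rewrite lift0.
apply: (@le_trans _ _ ((M * rho) ^+ (q ^ i.+1))).
  rewrite lerXn2r // ?nnegrE ?divr_ge0 ?(ltW (Qn_gt0 _)) //.
  by rewrite ler_pdivrMr ?Qn_gt0 // ler_peMr ?Qn_ge1.
by rewrite ler_wiXn2l ?qX_ge2.
Qed.

Lemma bounded_coef j : bounded (coef j).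
Proof.
case: j => [|j]; rewrite /phi_coef /=.
  by exists (Q * 1); rewrite -[th]mulr1 -nrm_theta; apply: nb_constM => nu;
     rewrite /GRing.one /= /tone /tconst; case: eqP => _; rewrite ?nrm1 ?nrm0.
case: leqP => Hj; last first.
  by exists M; apply: nb_A.
by exists 0; apply: nb0.
Qed.

Lemma frn_tconst n c : frn n (tconst c) = tconst (c ^+ (q ^ n)).
Proof.
apply: funext => nu; rewrite frnE /tconst; case: eqP => // _.
by rewrite expr0n -leqn0 leqNgt expn_gt0 (q_gt0 _ _ q_pchar).
Qed.

(** The coefficient recursion gives an exact identity between truncations, with orders shifted by at
    most [r]; the limit is then taken in each of the [r.+1] terms. *)
Lemma exp_functional x L L' :
  cv (exp ^~ x) L -> cv (exp ^~ (th * x)) L' -> L' = phi L.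
Proof.
move=> H H'; apply: cv_unique H' _.
have E N : exp N (th * x) = \sum_(j < r.+1) coef j * frn j (exp (N - j)%N x).
  rewrite -(act_tau_mul _ _ coef) => [|j]; last exact: phi_coef_gt.
  apply: eq_bigr => i _; rewrite -alpha_rec rmorphM /= frn_tconst; ring.
apply: cv_eq; first by exists 0%N => n _; rewrite E.
apply: cv_sum => j; apply: cvM (bounded_coef _) _.
exact: cv_frn (cv_shift j _ _ H).
Qed.

Lemma phi_small x B : nb x B -> M * B <= 1 -> nb (phi x) (Q * B).
Proof.
move=> hx hB; have B0 := nb_ge0 _ _ hx; have Mp := M_gt0.
have B1 : B <= 1 by apply: le_trans hB; rewrite ler_peMl.
rewrite phiE; apply: nbD; first by rewrite -nrm_theta; apply: nb_constM.
apply: nb_sum => [|j _]; first by rewrite mulr_ge0 // ltW // Q_gt0.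
apply: nb_le (nb_A_frn _ _ _ (ltn_ord j) hx).
apply: (@le_trans _ _ B); last by rewrite ler_peMl // ltW // Q_gt1.
apply: (@le_trans _ _ (M * B ^+ 2)).
  by rewrite ler_wpM2l ?(ltW Mp) // ler_wiXn2l // qX_ge2.
by rewrite expr2 mulrA ler_piMl.
Qed.

(* For small [v], [phi] multiplies norms by at most [q], so [q^n |v_n|] can only
   decrease along the chain and must vanish if it tends to [0]. *)
Lemma phi_chain_eq0 (v : nat -> T) d :
  (forall n, (d <= n)%N -> phi (v n.+1) = v n) ->
  (forall e, 0 < e -> exists N, forall n, (N <= n)%N -> nb (v n) (e / Q ^+ n)) ->
  forall n, (d <= n)%N -> v n = 0.
Proof.
move=> Hphi Hv n Hn; apply: nb_eq0 => e e0; have Mp := M_gt0.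
(* The bound [M^-1] keeps the whole chain inside the ball where [phi_small] applies. *)
pose e' := Num.min M^-1 e.
have e'0 : 0 < e' by rewrite lt_min invr_gt0 Mp.
have step m : nb (v (n + m)%N) (e' / Q ^+ (n + m)) -> nb (v n) (e' / Q ^+ n).
  elim: m => [|m IH]; first by rewrite addn0.
  rewrite addnS => h; apply: IH; rewrite -Hphi ?(leq_trans Hn) ?leq_addr //.
  apply: nb_le (phi_small _ _ h _).
    by rewrite exprS invfM mulrCA (mulrA Q) mulfV ?mul1r // gt_eqF ?Q_gt0.
  apply: (@le_trans _ _ (M * e')).
    by rewrite ler_wpM2l ?(ltW Mp) // ler_piMr ?(ltW e'0) // invf_le1 ?Qn_gt0 ?Qn_ge1.
  by rewrite -ler_pdivlMl // mulr1 ge_min lexx.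
have [N HN] := Hv e' e'0.
apply: nb_le (step N _); last by apply: HN; rewrite leq_addl.
apply: (@le_trans _ _ e'); last by rewrite ge_min lexx orbT.
by rewrite ler_piMr ?(ltW e'0) // invf_le1 ?Qn_gt0 ?Qn_ge1.
Qed.

Lemma nrm_thetaX n : nrm (theta ^+ n) = Q ^+ n.
Proof. by rewrite nrmX nrm_theta. Qed.

Lemma theta_neq0 : theta != 0.
Proof.
apply/eqP => /nrm_eq0/eqP; rewrite nrm_theta; apply/negP/lt0r_neq0/Q_gt0.
Qed.

Lemma nrm_thetaVX n : nrm (theta ^- n) = (Q ^+ n)^-1.
Proof.
apply: (mulfI (lt0r_neq0 (Qn_gt0 n))); rewrite [RHS]mulfV ?gt_eqF ?Qn_gt0 //.
by rewrite -nrm_thetaX -nrmM mulfV ?nrm1 // expf_neq0 // theta_neq0.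
Qed.

(** Applied with [p n = u_(n-1)]. Once [exp(theta^-d xi) = - p d] is known, [d] uses of the
    functional equation bring the identity back to [xi]. *)
Lemma exp_of_chain (p : nat -> T) d xi :
  (forall n, (d <= n)%N -> phi (p n.+1) = p n) ->
  cv (fun n => - (tconst (theta ^+ n) * p n)) xi -> bounded xi ->
  cv (exp ^~ xi) (- iter d phi (p d)).
Proof.
move=> Hp Hxi [rho hxi]; have Mp := M_gt0; have rho0 := nb_ge0 _ _ hxi.
pose w n : T := tconst (theta ^- n) * xi.
have hw n : nb (w n) ((Q ^+ n)^-1 * rho).
  by rewrite -nrm_thetaVX; apply: nb_constM.
have /choice[ew Hew] : forall n, exists L, cv (exp ^~ (w n)) L.
  by move=> n; apply: exp_cv; eexists; apply: hw.
have wS n : w n = th * w n.+1.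
  apply: funext => nu; rewrite /w !tconstME exprS invfM !mulrA mulfV ?theta_neq0 //.
  by rewrite mul1r.
have ewS n : ew n = phi (ew n.+1).
  by apply: exp_functional (Hew n.+1) _; rewrite -wS.
have vS n : (d <= n)%N -> phi (ew n.+1 + p n.+1) = ew n + p n.
  by move=> Hn; rewrite raddfD /= -ewS Hp.
have v0 := phi_chain_eq0 (fun n => ew n + p n) d vS.
have ewd : ew d = - p d.
  apply/eqP; rewrite -addr_eq0; apply/eqP; apply: v0 => // e e0 {vS}.
  have [N1 HN1] := Hxi e e0.
  (* The summand [M * rho] puts [w n] in the domain of [exp_near]; the other makes the quadratic
     error at most [e / Q ^+ n]. *)
  have [N2 HN2] : exists n : nat, (M * rho) ^+ 2 / e + M * rho <= n%:R.
    eexists; apply/ltW/archi_boundP.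
    by rewrite addr_ge0 ?divr_ge0 ?exprn_ge0 ?mulr_ge0 // ltW.
  have a0 : 0 <= M * rho by rewrite mulr_ge0 // ltW.
  have b0 : 0 <= (M * rho) ^+ 2 / e by rewrite divr_ge0 ?exprn_ge0 // ltW.
  exists (maxn N1 N2) => n; rewrite geq_max => /andP[h1 h2].
  have Qn : N2%:R <= Q ^+ n.
    by rewrite -natrX ler_nat (leq_trans h2) // leq_qX.
  have -> : ew n + p n = (ew n - w n) + (w n + p n) by ring.
  apply: nbD; last first.
    have -> : w n + p n = tconst (theta ^- n) * - (- (tconst (theta ^+ n) * p n) - xi).
      apply: funext => nu; rewrite /w tconstME !tserDE !tserNE !tserDE !tserNE !tconstME.
      by rewrite opprB opprK mulrDr mulrA mulVf ?mul1r // expf_neq0 ?theta_neq0.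
    rewrite [e / _]mulrC -nrm_thetaVX; apply: nb_constM; apply: nbN; exact: HN1.
  have h : M * ((Q ^+ n)^-1 * rho) <= 1.
    rewrite mulrCA mulrC ler_pdivrMr ?Qn_gt0 // mul1r.
    apply: le_trans Qn; apply: le_trans HN2; by rewrite lerDr.
  apply: nb_le (exp_near _ _ _ (hw n) h (Hew n)).
  have hQ : (M * rho) ^+ 2 / Q ^+ n <= e.
    rewrite ler_pdivrMr ?Qn_gt0 // [e * _]mulrC -ler_pdivrMr //.
    by apply: le_trans Qn; apply: le_trans HN2; rewrite lerDl.
  have -> : (M * ((Q ^+ n)^-1 * rho)) ^+ 2 = (M * rho) ^+ 2 / Q ^+ n / Q ^+ n by ring.
  by rewrite ler_pM2r ?invr_gt0 ?Qn_gt0.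
have iterE n : ew 0%N = iter n phi (ew n).
  by elim: n => // n IH; rewrite iterSr -ewS.
have iterN n x : iter n phi (- x) = - iter n phi x.
  by elim: n => // n IH; rewrite !iterS IH raddfN.
rewrite -iterN -ewd -iterE; have := Hew 0%N.
have -> // : w 0%N = xi.
by apply: funext => nu; rewrite /w tconstME expr0 invr1 mul1r.
Qed.

End NonArch.

(** * The system defining [g] *)

Lemma card_pchar_nat (F : finFieldType) (K : closedFieldType)
  (iF : {rmorphism F -> K}) : [pchar K].-nat #|F|.
Proof.
have [p p_pr pF] := finPcharP F.
rewrite (eq_pnat _ (fmorph_pchar iF)) (eq_pnat _ (pcharf_eq pF)).
by have /abelem_pgroup := fin_ring_pchar_abelem pF; rewrite /pgroup cardsT.
Qed.

Section Bounds.
Variables (R : realType) (K : closedFieldType) (nrm : K -> R).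
Hypothesis nrm_ge0 : forall x, 0 <= nrm x.
Hypothesis nrm_eq0 : forall x, nrm x = 0 <-> x = 0.
Hypothesis nrmM : forall x y, nrm (x * y) = nrm x * nrm y.
Hypothesis nrmD : forall x y, nrm (x + y) <= Num.max (nrm x) (nrm y).
Variable s : nat.
Local Notation T := (tser K s).
Local Notation nb := (nb R K nrm s).
Local Notation bounded := (bounded R K nrm s).

Lemma bounded_family (r : nat) (A : nat -> T) :
  (forall j, (1 <= j <= r)%N -> bounded (A j)) ->
  exists M, 1 <= M /\ forall j, (1 <= j <= r)%N -> nb (A j) M.
Proof.
elim: r => [|r IH] HA; first by exists 1; split=> // j; lia.
have [|M [M1 HM]] := IH; first by move=> j Hj; apply: HA; lia.
have [C hC] : bounded (A r.+1) by apply: HA; lia.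
exists (Num.max M C); split=> [|j Hj]; first by rewrite le_max M1.
case: (eqVneq j r.+1) => [->|Hne].
  by apply: nb_le hC; rewrite le_max lexx orbT.
by apply: nb_le (HM j _); [rewrite le_max lexx | lia].
Qed.

Lemma boundedM (x y : T) : bounded x -> bounded y -> bounded (x * y).
Proof. by move=> [B hB] [C hC]; exists (B * C); apply: nbM. Qed.

Lemma boundedB (x y : T) : bounded x -> bounded y -> bounded (x - y).
Proof.
move=> hx hy; have [B [_ hB hC]] := bounded_max _ _ _ _ _ _ hx hy.
by exists B; apply: nbB.
Qed.

Lemma cv_bounded S (L : T) : (forall n, bounded (S n)) -> cv R K nrm s S L -> bounded L.
Proof.
move=> HS /(_ 1 ltr01)[N /(_ N (leqnn N)) HN].
have -> : L = S N - (S N - L) by ring.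
by apply: boundedB => //; exists 1.
Qed.

Variable q : nat.
Hypothesis q_pchar : [pchar K].-nat q.

(** A root of norm above 1 is bounded by its own [q]-th power. *)
Lemma bounded_fri (x : T) : bounded x -> bounded (ttw q (-1) x).
Proof.
move=> [C hC]; exists (Num.max 1 C) => nu; rewrite [ttw _ _ _ _]/(qroot q (x nu)).
have Hy : nrm (qroot q (x nu)) ^+ q <= C.
  by rewrite -(nrmX R) // (qrootK _ _ q_pchar).
rewrite le_max; case: (lerP (nrm (qroot q (x nu))) 1) => //= y1; apply: le_trans Hy.
by rewrite -{1}(expr1 (nrm _)) ler_weXn2l ?(ltW y1) // (q_gt0 _ _ q_pchar).
Qed.

Lemma bounded_frin n (x : T) : bounded x -> bounded (frin T (ttw q (-1)) n x).
Proof. by move=> hx; elim: n => // n; apply: bounded_fri. Qed.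

End Bounds.

(** * From the matrix equation to a recursion on the coefficients of u *)

Section System.
Variables (K : closedFieldType) (s q r : nat) (theta : K).
Local Notation T := (tser K s).
Local Notation fri := (@ttw K s q (-1)).
Local Notation th := (tconst theta : T).
Variables (A : nat -> T) (Binv : T).

Lemma zmulE (a b : zser K s) k : zmul a b k = \sum_(m < k.+1) a m * b (k - m)%N :> T.
Proof. by apply: funext => nu; rewrite tser_sumE. Qed.

Lemma zmul_deg1 (a b : zser K s) k : (forall n, (1 < n)%N -> b n = 0 :> T) ->
  zmul a b k = (if k is k'.+1 then a k' * b 1%N else 0) + a k * b 0%N :> T.
Proof.
move=> Hb; rewrite zmulE big_ord_recr /= subnn; congr (_ + _).
case: k => [|k]; first by rewrite big_ord0.
rewrite big_ord_recr /= subSnn big1 ?add0r // => i _; rewrite Hb ?mulr0 //.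
by have := ltn_ord i; lia.
Qed.

Local Notation Phi := (Phi q theta A Binv).
Local Notation b := (frin T fri r.+1 Binv).

Lemma zmul_Phi_row (i j : 'I_r.+1) (a : zser K s) k : (i.+1 < r.+1)%N ->
  zmul a (Phi i j) k = if nat_of_ord j == i.+1 then a k else 0 :> T.
Proof.
move=> Hi; rewrite zmul_deg1 /Defs.Phi Hi; last by case.
rewrite /= -[@tone K s]/(1 : T) -[@tzero K s]/(0 : T).
by case: (nat_of_ord j == i.+1); case: k => [|k]; rewrite ?mulr0 ?mulr1 ?addr0 ?add0r.
Qed.

Lemma zmul_Phi_last0 (a : zser K s) k :
  zmul a (Phi (@ord_max r) ord0) k =
    (if k is k'.+1 then a k' * b else 0) - th * (a k * b) :> T.
Proof.
rewrite zmul_deg1 /Defs.Phi /= ltnn ttw_neg; last by case=> [|[]].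
case: k => [|k] /=; congr (_ + _);
  by apply: funext => nu; rewrite -[tmul _ _]/(tconst (- theta) * b : T)
    tserNE tconstME mulrCA tconstME mulNr.
Qed.

Lemma zmul_Phi_lastS (a : zser K s) k (j : 'I_r.+1) : j != ord0 ->
  zmul a (Phi (@ord_max r) j) k = - (frin T fri j (A j) * (a k * b)) :> T.
Proof.
move=> j0; rewrite zmul_deg1 /Defs.Phi /= ltnn.
  rewrite -val_eqE /= in j0; rewrite (negPf j0) /= !ttw_neg.
  have -> : (fun nu => - tmul (frin T fri j (A j)) b nu) = - (frin T fri j (A j) * b) :> T.
    by [].
  case: k => [|k] /=; first by rewrite add0r; ring.
  rewrite -[@tzero K s]/(0 : T); ring.
by rewrite -val_eqE /= in j0; rewrite (negPf j0); case.
Qed.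

Variables (g h : 'I_r.+1 -> zser K s).
Hypothesis system : forall (j : 'I_r.+1) k,
  \sum_(i < r.+1) zmul (ztw q (-1) (g i)) (Phi i j) k - g j k = h j k :> T.

Definition u_coef (k : nat) : T := fri (g ord_max k) * b.
(** The coefficients of [z u]. The value 0 at [k = 0] removes the initial term in both telescoping
    sums, for [xi] and for [Xi]. *)
Definition u_pred (k : nat) : T := if k is k'.+1 then u_coef k' else 0.

Lemma system0 k : (g ord0 k : T) + h ord0 k = u_pred k - th * u_coef k.
Proof.
rewrite -system addrC subrK big_ord_recr /= big1 ?add0r; last first.
  by move=> i _; rewrite zmul_Phi_row //= ltnS.
by rewrite zmul_Phi_last0; case: k.
Qed.

Hypothesis q_pchar : [pchar K].-nat q.
Local Notation fr := (tfr K s q q_pchar).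
Hypothesis AB : A r.+1 * Binv = 1.

(** [fri] picks roots by choice, so multiplicativity is checked after applying the Frobenius power,
    which has trivial kernel because [K] is a field. *)
Lemma frin_AB : frin T fri r.+1 (A r.+1) * b = 1.
Proof.
have E : frob_iter T fr r.+1 (frin T fri r.+1 (A r.+1) * b - 1) = 0.
  by rewrite rmorphB rmorphM /= !(frinK _ _ _ (tfriK _ _ _ q_pchar)) AB rmorph1 subrr.
apply/eqP; rewrite -subr_eq0; apply/eqP; apply: funext => nu.
have := congr1 (fun f : T => f nu) E; rewrite frnE => /eqP.
by rewrite expf_eq0 => /andP[_ /eqP].
Qed.

Lemma u_recursion k :
  u_pred k = phi_op T fr th A r.+1 (u_coef k) + \sum_(i < r.+1) frob_iter T fr i (h i k).
Proof.
have inord_ord (i : 'I_r.+1) : inord i = i by apply: inord_val.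
rewrite (phi_of_system _ _ _ (tfriK _ _ _ q_pchar) th A r.+1
  (fun j => g (inord j) k) (fun j => h (inord j) k) (u_pred k) (u_coef k)) //.
- by congr (_ + _); apply: eq_bigr => i _; rewrite inord_ord.
- have -> : inord 0 = ord0 :> 'I_r.+1 by apply: val_inj; rewrite /= inordK.
  exact: system0.
- move=> j Hj; rewrite -system addrC subrK big_ord_recr /=.
  rewrite zmul_Phi_lastS -?val_eqE /= inordK //; congr (_ - _).
  have Hj' : (j < r)%N by [].
  rewrite (bigD1 (Ordinal Hj')) //= zmul_Phi_row //= inordK // eqxx big1 ?addr0.
    by congr (fri (g _ k)); apply: val_inj; rewrite /= inordK // ltnW.
  move=> i Hi; rewrite zmul_Phi_row //= ?ltnS // inordK // eqSS.
  by rewrite -val_eqE /= eq_sym in Hi; rewrite (negPf Hi).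
have -> : inord r = ord_max :> 'I_r.+1 by apply: val_inj; rewrite /= inordK.
by rewrite /u_coef mulrCA frin_AB mulr1.
Qed.

End System.

(** * Evaluation of Xi and xi, and the conclusion *)

Section Exponential.
Variables (R : realType) (F : finFieldType) (K : closedFieldType)
  (iF : {rmorphism F -> K}) (nrm : K -> R) (theta : K).
Hypothesis HK : is_Cinfty iF nrm theta.
Variables (s r : nat) (A : nat -> tser K s) (Binv : tser K s).
Local Notation q := #|F|.
Local Notation T := (tser K s).
Let q_pchar := card_pchar_nat F K iF.
Local Notation fr := (tfr K s q q_pchar).
Local Notation fri := (@ttw K s q (-1)).
Local Notation th := (tconst theta : T).
Local Notation phi := (phi_op T fr th A r.+1).
Local Notation cv := (cv R K nrm s).
Local Notation bounded := (bounded R K nrm s).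
Hypothesis A_tate : forall j : nat, (1 <= j <= r.+1)%N -> tate nrm (A j).
Hypothesis B_tate : tate nrm Binv.
Hypothesis AB : A r.+1 * Binv = 1.
Variable alpha : nat -> T.
Hypothesis alpha0 : alpha 0%N = 1.
Hypothesis alpha_rec : forall (i : nat) nu,
      alpha i nu * tw #|F| (i%:Z) theta
      = theta * alpha i nu
        + \sum_(1 <= j < (minn i r.+1).+1)
            tmul (A j) (ttw #|F| (j%:Z) (alpha (i - j)%N)) nu.
Variables (h : 'I_r.+1 -> zser K s) (d : nat).
Hypothesis h_deg : forall i k, (d <= k)%N -> h i k = 0 :> T.
Variable g : 'I_r.+1 -> zser K s.
Hypothesis g_tate : forall i k, tate nrm (g i k).
Hypothesis g_cv : forall i (eps : R), 0 < eps -> exists N, forall k : nat, (N <= k)%N ->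
           forall nu, (#|F|%:R) ^+ k * nrm (g i k nu) < eps.
Hypothesis system : forall (j : 'I_r.+1) k,
  \sum_(i < r.+1) zmul (ztw q (-1) (g i)) (Phi q theta A Binv i j) k - g j k
    = h j k :> T.

Local Notation p := (u_pred K s q r Binv g).

Lemma alpha_tau_mul i : (tconst (theta ^+ (q ^ i)) : T) * alpha i =
    tau_mul T fr (phi_coef T th A r.+1) alpha i.
Proof.
apply: funext => nu; rewrite tconstME mulrC.
have -> : theta ^+ (q ^ i) = tw q i%:Z theta.
  elim: i => [|i IH]; first by rewrite expn0 expr1.
  by rewrite expnSr exprM IH.
rewrite alpha_rec /tau_mul big_ord_recl tserDE subn0.
congr (_ + _); first by rewrite -[RHS]/((th * alpha i : T) nu) tconstME.
rewrite tser_sumE big_add1 /= big_mkord.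
rewrite (big_ord_widen i (fun j => tmul (A j.+1)
   (ttw q j.+1%:Z (alpha (i - j.+1)%N)) nu)) ?geq_minl // big_mkcond.
apply: eq_bigr => j _; rewrite /bump /= add1n /phi_coef /= leq_min ltn_ord /=.
case: leqP => Hj; first by rewrite mul0r.
by rewrite ttw_pos.
Qed.

Local Notation H := (fun k => \sum_(i < r.+1) frob_iter T fr i (h i k)).

(** With [i <= r] and [k < d], the sigma-degree [i + r.+1 * k] stays below the cut-off, so [delta1]
    sees every coefficient of [iota_h]. *)
Lemma delta1_iota_h :
  delta1 q (r.+1 * d + r.+1) (iota_h q d theta A h) = \sum_(k < d) iter k phi (H k).
Proof.
pose ps := phistar q r.+1 theta A.
have tilde_ps : tau_of_sigma T fr ps = phi_coef T th A r.+1.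
  apply: funext => -[|n]; rewrite /tau_of_sigma /ps /phistar /phi_coef //=.
  case: leqP => Hn; first by rewrite -[@tzero K s]/(0 : T) rmorph0.
  by rewrite ttw_neg frinK //; apply: tfriK.
have tpmE P Q : tpmul q P Q = sigma_mul T fri P Q.
  apply: funext => n; apply: funext => nu; rewrite /sigma_mul tser_sumE.
  by apply: eq_bigr => m _; rewrite ttw_neg.
have tpE k : tppow q ps k = sigma_exp T fri ps k.
  by elim: k => // k IH; rewrite /tppow iterS -/(tppow _ _ _) IH tpmE.
transitivity (\sum_(n < r.+1 * d + r.+1) frob_iter T fr n (\sum_(i < r.+1) \sum_(k < d)
    h i k * sigma_mul T fri (sigma_pow T i) (sigma_exp T fri ps k) n)).
  apply: funext => nu; rewrite /delta1 tser_sumE; apply: eq_bigr => n _.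
  rewrite -ttw_pos /ttw /iota_h; congr (tw _ _ _).
  rewrite tser_sumE; apply: eq_bigr => i _; rewrite tser_sumE.
  by apply: eq_bigr => k _; rewrite tpmE tpE.
under eq_bigr do rewrite raddf_sum.
rewrite exchange_big /=.
under eq_bigr do under eq_bigr do rewrite raddf_sum.
under eq_bigr do rewrite exchange_big /=.
rewrite exchange_big /=; apply: eq_bigr => k _.
have iter_sum (I : Type) (l : seq I) (G : I -> T) :
    iter k phi (\sum_(i <- l) G i) = \sum_(i <- l) iter k phi (G i).
  by elim: (nat_of_ord k) => // m IH; rewrite iterS IH raddf_sum.
rewrite iter_sum; apply: eq_bigr => i _.
rewrite (delta1_sigma_exp T fr _ (tfriK _ _ _ q_pchar) _ _ _ _ tilde_ps) //.
have := ltn_ord i; have := ltn_ord k; nia.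
Qed.

Lemma zeval_partialE n : zeval_partial theta (fun k nu => g ord0 k nu + h ord0 k nu) n
  = - (tconst (theta ^+ n) * p n) :> T.
Proof.
apply: funext => nu; rewrite tserNE tconstME /zeval_partial.
elim: n => [|n IH]; first by rewrite big_ord0 mulr0 oppr0.
rewrite big_ord_recr /= IH -[g _ _ _ + _]/((g ord0 n + h ord0 n : T) nu).
rewrite (system0 _ _ _ _ _ A Binv g h system) tserDE tserNE tconstME exprS; ring.
Qed.

Lemma exp_xi : exists xi : T,
  cv (zeval_partial theta (fun k nu => g ord0 k nu + h ord0 k nu)) xi /\
  cv (tau_act T fr alpha ^~ xi) (delta1 q (r.+1 * d + r.+1) (iota_h q d theta A h)).
Proof.
have [n0 [nz [nM [nD [comp [ntheta _]]]]]] := HK.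
have q_gt1 : (1 < q)%N := finNzRing_gt1 F.
have tateb := tate_bounded R K nrm n0 s.
have [M [M1 HM]] := bounded_family R K nrm s r.+1 A (fun j Hj => tateb _ (A_tate j Hj)).
have pS k : p k = phi (p k.+1) + H k.
  exact: (u_recursion K s q r theta A Binv g h system q_pchar AB k).
have [xi Hxi] : exists xi,
    cv (zeval_partial theta (fun k nu => g ord0 k nu + h ord0 k nu)) xi.
  pose f k : T := tconst (theta ^+ k) * (g ord0 k + h ord0 k).
  have [|xi Hxi] := cv_series R K nrm n0 nz nM nD s comp f.
    move=> e e0; have [N HN] := g_cv ord0 e e0; exists (maxn N d) => k.
    rewrite geq_max => /andP[h1 h2] nu.
    rewrite /f tconstME nM (nrmX R K nrm nz nM) ntheta h_deg // addr0.
    exact/ltW/HN.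
  exists xi; apply: cv_eq Hxi; exists 0%N => n _.
  apply: funext => nu; rewrite tser_sumE; apply: eq_bigr => k _.
  by rewrite /f tconstME tserDE mulrC.
exists xi; split=> //.
have {}Hxi : cv (fun n => - (tconst (theta ^+ n) * p n)) xi.
  by apply: cv_eq Hxi; exists 0%N => n _; apply: zeval_partialE.
have pb n : bounded (p n).
  case: n => [|n]; first by exists 0; apply: nb0.
  apply: boundedM => //; first by apply: bounded_fri => //; apply: tateb.
  by apply: bounded_frin => //; apply: tateb.
have xib : bounded xi.
  apply: cv_bounded Hxi => // n; have [B HB'] := pb n.
  by exists (nrm (theta ^+ n) * B); apply: nbN => //; apply: nb_constM.
rewrite delta1_iota_h (iter_phi_telescope _ _ _ _ _ p _ d pS) sub0r.
apply: (exp_of_chain R K nrm n0 nz nM nD s comp q q_pchar q_gt1 theta ntheta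
  r.+1 A M (ltn0Sn r) M1 HM alpha alpha0 alpha_tau_mul p d xi) => // n Hn.
(* Beyond the degree of [h] the recursion loses its inhomogeneous term, which is the chain
   condition. *)
by rewrite [RHS]pS big1 ?addr0 // => i _; rewrite h_deg // rmorph0.
Qed.

End Exponential.

Theorem theorem4p8
  (R : realType) (F : finFieldType) (K : closedFieldType)
  (iF : {rmorphism F -> K}) (nrm : K -> R) (theta : K)
  (HK : is_Cinfty iF nrm theta)
  (s r : nat) (Hr : (0 < r)%N)
  (* phi_theta = theta + A 1 tau + ... + A r tau^r, A_j in T_s *)
  (A : nat -> tser K s)
  (HA : forall j : nat, (1 <= j <= r)%N -> tate nrm (A j))
  (* A_r is a unit of T_s, with inverse Binv *)
  (Binv : tser K s) (HB : tate nrm Binv)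
  (HAB : forall nu, tmul (A r) Binv nu = tone K nu)
  (* exp_phi = sum_i alpha_i tau^i : alpha_0 = 1, exp_phi theta = phi_theta exp_phi *)
  (alpha : nat -> tser K s)
  (Halpha0 : forall nu, alpha 0%N nu = tone K nu)
  (Halpha : forall (i : nat) nu,
      alpha i nu * tw #|F| (i%:Z) theta
      = theta * alpha i nu
        + \sum_(1 <= j < (minn i r).+1)
            tmul (A j) (ttw #|F| (j%:Z) (alpha (i - j)%N)) nu)
  (* h in Mat_{1 x r}(T_s[z]), of z-degree < d *)
  (h : 'I_r -> zser K s) (d : nat)
  (Hh : forall i k, tate nrm (h i k))
  (Hhd : forall i k, (d <= k)%N -> forall nu, h i k nu = 0)
  (* g in Mat_{1 x r}(T_s{z/theta}) *)
  (g : 'I_r -> zser K s)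
  (Hg : forall i k, tate nrm (g i k))
  (Hgc : forall i (eps : R), 0 < eps -> exists N, forall k : nat, (N <= k)%N ->
           forall nu, (#|F|%:R) ^+ k * nrm (g i k nu) < eps)
  (* g^{(-1)} Phi - g = h *)
  (Heq : forall (j : 'I_r) (k : nat) nu,
      \sum_(i < r) zmul (ztw #|F| (-1) (g i)) (Phi #|F| theta A Binv i j) k nu
        - g j k nu = h j k nu) :
  let Xi := delta1 #|F| (r * d + r) (iota_h #|F| d theta A h) in
  exists xi : tser K s,
    (* xi = (g_1 + h_1)|_{z = theta} *)
    tconv nrm (zeval_partial theta (fun k nu => g (Ordinal Hr) k nu + h (Ordinal Hr) k nu)) xi
    (* exp_phi(xi) = sum_i alpha_i xi^{(i)} = Xi *)
    /\ tconv nrm (fun n nu => \sum_(i < n) tmul (alpha i) (ttw #|F| (i%:Z) xi) nu) Xi.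
Proof.
case: r Hr A HA HAB Halpha h Hh Hhd g Hg Hgc Heq => // r' Hr' A HA HAB Halpha
  h Hh Hhd g Hg Hgc Heq Xi.
have -> : Ordinal Hr' = ord0 by apply: val_inj.
have [||||xi [Hxi Hexp]] := exp_xi R F K iF nrm theta HK s r' A Binv HA HB _
  alpha _ Halpha h d _ g Hg Hgc.
- by apply: funext => nu; apply: HAB.
- by apply: funext => nu; apply: Halpha0.
- by move=> i k Hk; apply: funext => nu; apply: Hhd.
- by move=> j k; apply: funext => nu; rewrite -Heq tserDE tserNE tser_sumE.
exists xi; split; apply: cv_tconv => //.
apply: cv_eq Hexp; exists 0%N => n _; apply: funext => nu; rewrite /tau_act tser_sumE.
by apply: eq_bigr => i _; rewrite (ttw_pos _ _ _ (card_pchar_nat F K iF)).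
Qed.
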